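(* The pair of functors $\mathcal{M}at:\mathbf{CSRng}\to\mathbf{SMBLaw}$ and $\mathcal{H}:\mathbf{SMBLaw}\to\mathbf{CSRng}$ forms an adjunction $\mathcal{M}at\dashv\mathcal{H}$.
   Context: $\mathbf{CSRng}$: commutative semirings $(S,+,0,\cdot,1)$ in sets, i.e. two commutative monoid structures with $s\cdot0=0$ and $s\cdot(t+r)=s\cdot t+s\cdot r$, with structure-preserving maps. Lawvere theories. Let $\underline{n}=\{0,\ldots,n-1\}$. $\aleph_0$ has natural numbers as objects and functions $\underline n\to\underline m$ as morphisms; $(+,0)$ gives finite coproducts. A Lawvere theory is a small category $\mathbf{L}$ with natural numbers as objects together with a functor $\aleph_0\to\mathbf{L}$ that is the identity on objects and strictly preserves finite coproducts; morphisms are identity-on-objects functors strictly preserving finite coproducts. $\aleph_0$ has a symmetric monoidal structure: $n\otimes m=n\times m$ (multiplication), unit $1$, $f\otimes g=\mathsf{co}^{-1}\circ(f\times g)\circ\mathsf{co}$ where $\mathsf{co}:\underline{n\times m}\to\underline n\times\underline m$ is the bijection with $\mathsf{co}(c)=(a,b)\iff c=a\cdot m+b$, and the monoidal isomorphisms are transported from $(\mathbf{Sets},\times,1)$ along $\mathsf{co}$. $\mathbf{SMBLaw}$: objects are Lawvere theories $\mathbf{L}$ with a symmetric monoidal structure strictly preserved by $\aleph_0\to\mathbf{L}$, in which $(+,0)$ forms biproducts, i.e. $0$ is a zero object and each $n+m$ is also a product with projections satisfying $\pi_j\circ\kappa_i=\mathrm{id}$ if $i=j$ and $\pi_j\circ\kappa_i=0$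 (zero map) if $i\ne j$. Morphisms are identity-on-objects functors strictly preserving all the structure. Functor $\mathcal{M}at$: morphisms $n\to m$ in $\mathcal{M}at(S)$ are functions $\underline n\times\underline m\to S$ ($n\times m$ matrices over $S$); identities are identity matrices; composition of $g:n\to m$ and $h:m\to p$ is $(h\circ g)(i,k)=\sum_jg(i,j)\cdot h(j,k)$. Coprojections: $\kappa_1:n\to n+m$ has $\kappa_1(i,j)=1$ if $i=j$ and $0$ otherwise; $\kappa_2:m\to n+m$ has $\kappa_2(i,j)=1$ if $j\geq n$ and $j-n=i$, and $0$ otherwise; projections are given by the transposed matrices. The tensor of $g:m\to p$ and $h:n\to q$ is $(g\otimes h)((i_0,i_1),(j_0,j_1))=g(i_0,j_0)\cdot h(i_1,j_1)$ (with pairs identified with numbers via $\mathsf{co}$). A semiring map $f$ acts on matrices by post-composition, $h\mapsto f\circ h$. Functor $\mathcal{H}$: $\mathcal{H}(\mathbf{L})=\mathbf{L}(1,1)$, with multiplication given by composition (commutative, since $1$ is the tensor unit), unit $\mathrm{id}_1$, addition $f+g=[\mathrm{id},\mathrm{id}]\circ(f\oplus g)\circ\langle\mathrm{id},\mathrm{id}\rangle$ where $\oplus$ is the biproduct, and zero the zero map; a morphism $F$ is sent to its restriction to $\mathbf{L}(1,1)$. *)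

(* Defs.v *)
From HB Require Import structures.
From mathcomp Require Import all_boot all_algebra.
From mathcomp Require Import boolp mxtens.

Set Implicit Arguments.
Unset Strict Implicit.
Unset Printing Implicit Defensive.

Import GRing.Theory.

Reserved Notation "g ∘ f" (at level 40, left associativity).
Reserved Notation "f ⊗ g" (at level 40, left associativity).
Reserved Notation "f ⊕ g" (at level 50, left associativity).

(* The objects are a parameter, so that "a category whose objects are the
   natural numbers" and "an identity-on-objects functor" can be said without
   equalities between objects. *)
Record category_on (O : Type) := CategoryOn {
  hom : O -> O -> Type;
  idm : forall x, hom x x;
  comp : forall x y z, hom y z -> hom x y -> hom x z;
  compA : forall x y z w (h : hom z w) (g : hom y z) (f : hom x y),
    comp h (comp g f) = comp (comp h g) f;
  comp1m : forall x y (f : hom x y), comp (idm y) f = f;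
  compm1 : forall x y (f : hom x y), comp f (idm x) = f }.

Arguments idm {O C} x : rename.
Notation "g ∘ f" := (comp g f).

Record category := Category {
  obj :> Type;
  cat_struct :> category_on obj }.

Record functor (C D : category) := Functor {
  fobj :> C -> D;
  fmap : forall x y : C, hom C x y -> hom D (fobj x) (fobj y);
  fmap1 : forall x : C, fmap (idm x) = idm (fobj x);
  fmapM : forall (x y z : C) (g : hom C y z) (f : hom C x y),
    fmap (g ∘ f) = fmap g ∘ fmap f }.

(* F is left adjoint to G: bijections D(F x, y) -> C(x, G y), natural in x
   and y. *)
Definition adjoint (C D : category) (F : functor C D) (G : functor D C) :=
  exists phi : forall (x : C) (y : D), hom D (F x) y -> hom C x (G y),
    (forall x y, bijective (@phi x y)) /\
    (forall (x x' : C) (y y' : D)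
            (f : hom C x' x) (h : hom D (F x) y) (g : hom D y y'),
      phi x' y' (g ∘ h ∘ fmap F f) = fmap G g ∘ phi x y h ∘ f).

Record io_functor (O : Type) (C D : category_on O) := IoFunctor {
  iomap : forall x y, hom C x y -> hom D x y;
  iomap1 : forall x, iomap (idm x) = idm x;
  iomapM : forall x y z (g : hom C y z) (f : hom C x y),
    iomap (g ∘ f) = iomap g ∘ iomap f }.

Arguments iomap {O C D} F {x y} f : rename.

Definition is_iso (O : Type) (C : category_on O) x y (f : hom C x y) :=
  exists g : hom C y x, g ∘ f = idm x /\ f ∘ g = idm y.

(* Finite coproducts, given on objects by the operations add and zero. *)
Record coproducts (O : Type) (C : category_on O)
    (add : O -> O -> O) (zero : O) := Coproducts {
  init : forall x, hom C zero x;
  init_uniq : forall x (f : hom C zero x), f = init x;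
  inj1 : forall x y, hom C x (add x y);
  inj2 : forall x y, hom C y (add x y);
  cotuple : forall x y z, hom C x z -> hom C y z -> hom C (add x y) z;
  cotuple1 : forall x y z (f : hom C x z) (g : hom C y z),
    cotuple f g ∘ inj1 x y = f;
  cotuple2 : forall x y z (f : hom C x z) (g : hom C y z),
    cotuple f g ∘ inj2 x y = g;
  cotuple_uniq : forall x y z (h : hom C (add x y) z),
    h = cotuple (h ∘ inj1 x y) (h ∘ inj2 x y) }.

Definition osum (O : Type) (C : category_on O) (add : O -> O -> O) (zero : O)
    (K : coproducts C add zero) x y x' y' (f : hom C x x') (g : hom C y y') :
    hom C (add x y) (add x' y') :=
  cotuple K (inj1 K x' y' ∘ f) (inj2 K x' y' ∘ g).

(* Initial maps and cotuples are determined by universal properties, hence are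
   preserved as soon as the coprojections are. *)
Definition preserves_coproducts (O : Type) (C D : category_on O)
    (add : O -> O -> O) (zero : O) (K : coproducts C add zero)
    (K' : coproducts D add zero) (F : io_functor C D) :=
  (forall x y, iomap F (inj1 K x y) = inj1 K' x y) /\
  (forall x y, iomap F (inj2 K x y) = inj2 K' x y).

(* The given coproducts are biproducts: zero is also terminal, and add x y is
   also a product, with projections compatible with the coprojections. *)
Record biproducts (O : Type) (C : category_on O)
    (add : O -> O -> O) (zero : O) (K : coproducts C add zero) := Biproducts {
  term : forall x, hom C x zero;
  term_uniq : forall x (f : hom C x zero), f = term x;
  proj1 : forall x y, hom C (add x y) x;
  proj2 : forall x y, hom C (add x y) y;
  tuple : forall x y z, hom C z x -> hom C z y -> hom C z (add x y);
  tuple1 : forall x y z (f : hom C z x) (g : hom C z y),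
    proj1 x y ∘ tuple f g = f;
  tuple2 : forall x y z (f : hom C z x) (g : hom C z y),
    proj2 x y ∘ tuple f g = g;
  tuple_uniq : forall x y z (h : hom C z (add x y)),
    h = tuple (proj1 x y ∘ h) (proj2 x y ∘ h);
  proj1_inj1 : forall x y, proj1 x y ∘ inj1 K x y = idm x;
  proj2_inj2 : forall x y, proj2 x y ∘ inj2 K x y = idm y;
  proj1_inj2 : forall x y, proj1 x y ∘ inj2 K x y = init K x ∘ term y;
  proj2_inj1 : forall x y, proj2 x y ∘ inj1 K x y = init K y ∘ term x }.

Definition zero_map (O : Type) (C : category_on O) (add : O -> O -> O)
    (zero : O) (K : coproducts C add zero) (B : biproducts K) x y : hom C x y :=
  init K y ∘ term B x.

Definition preserves_biproducts (O : Type) (C D : category_on O)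
    (add : O -> O -> O) (zero : O) (K : coproducts C add zero)
    (K' : coproducts D add zero) (B : biproducts K) (B' : biproducts K')
    (F : io_functor C D) :=
  [/\ preserves_coproducts K K' F,
      forall x y, iomap F (proj1 B x y) = proj1 B' x y &
      forall x y, iomap F (proj2 B x y) = proj2 B' x y].

(* Symmetric monoidal structures, given on objects by ten and unit. *)
Record symmonoidal (O : Type) (C : category_on O)
    (ten : O -> O -> O) (unit : O) := SymMonoidal {
  tensor : forall x x' y y', hom C x x' -> hom C y y' ->
    hom C (ten x y) (ten x' y');
  tensor1 : forall x y, tensor (idm x) (idm y) = idm (ten x y);
  tensorM : forall x x' x'' y y' y''
    (f' : hom C x' x'') (f : hom C x x') (g' : hom C y' y'') (g : hom C y y'),
    tensor (f' ∘ f) (g' ∘ g) = tensor f' g' ∘ tensor f g;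
  assoc : forall x y z, hom C (ten (ten x y) z) (ten x (ten y z));
  lunit : forall x, hom C (ten unit x) x;
  runit : forall x, hom C (ten x unit) x;
  swap : forall x y, hom C (ten x y) (ten y x);
  assoc_iso : forall x y z, is_iso (assoc x y z);
  lunit_iso : forall x, is_iso (lunit x);
  runit_iso : forall x, is_iso (runit x);
  assoc_nat : forall x x' y y' z z'
    (f : hom C x x') (g : hom C y y') (h : hom C z z'),
    assoc x' y' z' ∘ tensor (tensor f g) h =
    tensor f (tensor g h) ∘ assoc x y z;
  lunit_nat : forall x x' (f : hom C x x'),
    lunit x' ∘ tensor (idm unit) f = f ∘ lunit x;
  runit_nat : forall x x' (f : hom C x x'),
    runit x' ∘ tensor f (idm unit) = f ∘ runit x;
  swap_nat : forall x x' y y' (f : hom C x x') (g : hom C y y'),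
    swap x' y' ∘ tensor f g = tensor g f ∘ swap x y;
  pentagon : forall w x y z,
    assoc w x (ten y z) ∘ assoc (ten w x) y z =
    tensor (idm w) (assoc x y z) ∘ assoc w (ten x y) z
      ∘ tensor (assoc w x y) (idm z);
  triangle : forall x y,
    tensor (idm x) (lunit y) ∘ assoc x unit y = tensor (runit x) (idm y);
  hexagon : forall x y z,
    assoc y z x ∘ swap x (ten y z) ∘ assoc x y z =
    tensor (idm y) (swap x z) ∘ assoc y x z ∘ tensor (swap x y) (idm z);
  lunit_swap : forall x, lunit x ∘ swap x unit = runit x;
  swapK : forall x y, swap y x ∘ swap x y = idm (ten x y) }.

Record preserves_symmonoidal (O : Type) (C D : category_on O)
    (ten : O -> O -> O) (unit : O) (T : symmonoidal C ten unit)
    (T' : symmonoidal D ten unit) (F : io_functor C D) : Prop :=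
  PreservesSymMonoidal {
  pres_tensor : forall x x' y y' (f : hom C x x') (g : hom C y y'),
    iomap F (tensor T f g) = tensor T' (iomap F f) (iomap F g);
  pres_assoc : forall x y z, iomap F (assoc T x y z) = assoc T' x y z;
  pres_lunit : forall x, iomap F (lunit T x) = lunit T' x;
  pres_runit : forall x, iomap F (runit T x) = runit T' x;
  pres_swap : forall x y, iomap F (swap T x y) = swap T' x y }.

Definition aleph0 : category_on nat :=
  @CategoryOn nat (fun n m => 'I_n -> 'I_m) (fun n i => i)
    (fun n m p g f i => g (f i))
    (fun _ _ _ _ _ _ _ => erefl) (fun _ _ _ => erefl) (fun _ _ _ => erefl).

Section Aleph0Coproducts.

Definition a0_init (n : nat) : hom aleph0 0 n :=
  fun i : 'I_0 => match notF (ltn_ord i) with end.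

Definition a0_cotuple (n m p : nat) (f : hom aleph0 n p) (g : hom aleph0 m p) :
    hom aleph0 (n + m) p :=
  fun i => match split i with inl j => f j | inr k => g k end.

Lemma a0_init_uniq n (f : hom aleph0 0 n) : f = a0_init n.
Proof. by apply/functional_extensionality_dep => -[]. Qed.

Lemma a0_cotuple1 n m p (f : hom aleph0 n p) (g : hom aleph0 m p) :
  comp (c := aleph0) (a0_cotuple f g) (@lshift n m) = f.
Proof.
apply/functional_extensionality_dep => i.
by rewrite /= /a0_cotuple (unsplitK (inl i)).
Qed.

Lemma a0_cotuple2 n m p (f : hom aleph0 n p) (g : hom aleph0 m p) :
  comp (c := aleph0) (a0_cotuple f g) (@rshift n m) = g.
Proof.
apply/functional_extensionality_dep => i.
by rewrite /= /a0_cotuple (unsplitK (inr i)).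
Qed.

Lemma a0_cotuple_uniq n m p (h : hom aleph0 (n + m) p) :
  h = a0_cotuple (comp (c := aleph0) h (@lshift n m))
                 (comp (c := aleph0) h (@rshift n m)).
Proof.
apply/functional_extensionality_dep => i.
by rewrite /a0_cotuple -{1}(splitK i); case: (split i).
Qed.

End Aleph0Coproducts.

Definition aleph0_coproducts : coproducts aleph0 addn 0 :=
  @Coproducts nat aleph0 addn 0 a0_init a0_init_uniq
    (fun n m => @lshift n m) (fun n m => @rshift n m)
    a0_cotuple a0_cotuple1 a0_cotuple2 a0_cotuple_uniq.

(* co c = (a, b) iff c = a * m + b: these are the library's bijections. *)
Definition co (n m : nat) : 'I_(n * m) -> 'I_n * 'I_m := @mxtens_unindex n m.
Definition coV (n m : nat) : 'I_n * 'I_m -> 'I_(n * m) := @mxtens_index n m.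

Lemma coK n m : cancel (@co n m) (@coV n m).
Proof. exact: mxtens_unindexK. Qed.

Lemma coVK n m : cancel (@coV n m) (@co n m).
Proof. exact: mxtens_indexK. Qed.

Lemma coKp n m (c : 'I_(n * m)) : coV ((co c).1, (co c).2) = c.
Proof. by rewrite -surjective_pairing coK. Qed.

Section Aleph0Monoidal.
Opaque co coV.

Definition a0_tensor (n n' m m' : nat)
    (f : hom aleph0 n n') (g : hom aleph0 m m') : hom aleph0 (n * m) (n' * m') :=
  fun c => coV (f (co c).1, g (co c).2).

Definition a0_assoc (n m p : nat) : hom aleph0 (n * m * p) (n * (m * p)) :=
  fun c => coV ((co (co c).1).1, coV ((co (co c).1).2, (co c).2)).

Definition a0_assocV (n m p : nat) : hom aleph0 (n * (m * p)) (n * m * p) :=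
  fun c => coV (coV ((co c).1, (co (co c).2).1), (co (co c).2).2).

Definition a0_lunit (n : nat) : hom aleph0 (1 * n) n := fun c => (co c).2.
Definition a0_lunitV (n : nat) : hom aleph0 n (1 * n) := fun i => coV (ord0, i).
Definition a0_runit (n : nat) : hom aleph0 (n * 1) n := fun c => (co c).1.
Definition a0_runitV (n : nat) : hom aleph0 n (n * 1) := fun i => coV (i, ord0).

Definition a0_swap (n m : nat) : hom aleph0 (n * m) (m * n) :=
  fun c => coV ((co c).2, (co c).1).

Lemma a0_assocK n m p : cancel (@a0_assoc n m p) (@a0_assocV n m p).
Proof. by move=> c; rewrite /a0_assoc /a0_assocV !coVK /= ?coVK !coKp. Qed.

Lemma a0_assocVK n m p : cancel (@a0_assocV n m p) (@a0_assoc n m p).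
Proof. by move=> c; rewrite /a0_assoc /a0_assocV !coVK /= ?coVK !coKp. Qed.

Lemma a0_lunitK n : cancel (@a0_lunit n) (@a0_lunitV n).
Proof.
by move=> c; rewrite -[RHS]coKp [(co c).1]ord1.
Qed.

Lemma a0_lunitVK n : cancel (@a0_lunitV n) (@a0_lunit n).
Proof. by move=> i; rewrite /a0_lunit coVK. Qed.

Lemma a0_runitK n : cancel (@a0_runit n) (@a0_runitV n).
Proof.
by move=> c; rewrite -[RHS]coKp [(co c).2]ord1.
Qed.

Lemma a0_runitVK n : cancel (@a0_runitV n) (@a0_runit n).
Proof. by move=> i; rewrite /a0_runit coVK. Qed.

Lemma a0_swapK n m : cancel (@a0_swap n m) (@a0_swap m n).
Proof. by move=> c; rewrite /a0_swap coVK /= coKp. Qed.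

Lemma a0_cancel_iso n m (f : hom aleph0 n m) (g : hom aleph0 m n) :
  cancel f g -> cancel g f -> is_iso f.
Proof. by move=> fK gK; exists g; split; apply/functional_extensionality_dep. Qed.

Definition aleph0_symmonoidal : symmonoidal aleph0 muln 1.
Proof.
refine (@SymMonoidal nat aleph0 muln 1 a0_tensor _ _
  a0_assoc a0_lunit a0_runit a0_swap _ _ _ _ _ _ _ _ _ _ _ _).
- by move=> n m; apply/functional_extensionality_dep => c; rewrite /a0_tensor coKp.
- by move=> *; apply/functional_extensionality_dep => c; rewrite /= /a0_tensor ?(coVK, coKp).
- by move=> n m p; apply: a0_cancel_iso (@a0_assocK n m p) (@a0_assocVK n m p).
- by move=> n; apply: a0_cancel_iso (@a0_lunitK n) (@a0_lunitVK n).
- by move=> n; apply: a0_cancel_iso (@a0_runitK n) (@a0_runitVK n).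
- by move=> *; apply/functional_extensionality_dep => c; rewrite /= /a0_tensor /a0_assoc ?(coVK, coKp).
- by move=> *; apply/functional_extensionality_dep => c; rewrite /= /a0_tensor /a0_lunit ?(coVK, coKp).
- by move=> *; apply/functional_extensionality_dep => c; rewrite /= /a0_tensor /a0_runit ?(coVK, coKp).
- by move=> *; apply/functional_extensionality_dep => c; rewrite /= /a0_tensor /a0_swap ?(coVK, coKp).
- by move=> *; apply/functional_extensionality_dep => c; rewrite /= /a0_tensor /a0_assoc !coVK /= ?(coVK, coKp).
- by move=> *; apply/functional_extensionality_dep => c; rewrite /= /a0_tensor /a0_assoc /a0_lunit /a0_runit ?(coVK, coKp).
- by move=> *; apply/functional_extensionality_dep => c; rewrite /= /a0_tensor /a0_assoc /a0_swap !coVK /= ?(coVK, coKp).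
- by move=> *; apply/functional_extensionality_dep => c; rewrite /= /a0_lunit /a0_swap ?(coVK, coKp).
- by move=> n m; apply/functional_extensionality_dep => c; rewrite /= a0_swapK.
Defined.

End Aleph0Monoidal.

Record lawvere := Lawvere {
  law_cat :> category_on nat;
  law_coprod : coproducts law_cat addn 0;
  law_incl : io_functor aleph0 law_cat;
  law_inclP : preserves_coproducts aleph0_coproducts law_coprod law_incl }.

(* Strict preservation by the identity-on-objects functor from aleph0 forces
   the tensor product to be multiplication on objects, with unit 1. *)
Record smblaw := SMBLawvere {
  smb_law :> lawvere;
  smb_mon : symmonoidal smb_law muln 1;
  smb_inclP :
    preserves_symmonoidal aleph0_symmonoidal smb_mon (law_incl smb_law);
  smb_biprod : biproducts (law_coprod smb_law) }.

Record smblaw_hom (L M : smblaw) := SMBLawHom {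
  smb_fun :> io_functor L M;
  smb_fun_biprod : preserves_biproducts (smb_biprod L) (smb_biprod M) smb_fun;
  smb_fun_mon : preserves_symmonoidal (smb_mon L) (smb_mon M) smb_fun }.

Lemma smblaw_hom_eq (L M : smblaw) (F G : smblaw_hom L M) :
  (forall n m (f : hom L n m), iomap F f = iomap G f) -> F = G.
Proof.
case: F G => [[F F1 FM] FB FT] [[G G1 GM] GB GT] /= eqFG.
have {eqFG} eqFG : F = G.
  by do 3!apply/functional_extensionality_dep => ?; apply: eqFG.
case: G / eqFG in G1 GM GB GT *.
rewrite (Prop_irrelevance F1 G1) (Prop_irrelevance FM GM) in FB FT *.
by rewrite (Prop_irrelevance FB GB) (Prop_irrelevance FT GT).
Qed.

Section SMBLaw.

Definition io_id (O : Type) (C : category_on O) : io_functor C C :=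
  @IoFunctor O C C (fun _ _ f => f) (fun _ => erefl) (fun _ _ _ _ _ => erefl).

Lemma io_comp1 (O : Type) (C D E : category_on O) (G : io_functor D E)
  (F : io_functor C D) x : iomap G (iomap F (idm x)) = idm x.
Proof. by rewrite !iomap1. Qed.

Lemma io_compM (O : Type) (C D E : category_on O) (G : io_functor D E)
  (F : io_functor C D) x y z (g : hom C y z) (f : hom C x y) :
  iomap G (iomap F (g ∘ f)) = iomap G (iomap F g) ∘ iomap G (iomap F f).
Proof. by rewrite !iomapM. Qed.

Definition io_comp (O : Type) (C D E : category_on O) (G : io_functor D E)
    (F : io_functor C D) : io_functor C E :=
  @IoFunctor O C E (fun _ _ f => iomap G (iomap F f)) (io_comp1 G F) (io_compM G F).

Definition smblaw_id (L : smblaw) : smblaw_hom L L.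
Proof. by exists (io_id L). Defined.

Definition smblaw_comp (L M N : smblaw) (G : smblaw_hom M N)
  (F : smblaw_hom L M) : smblaw_hom L N.
Proof.
exists (io_comp G F).
- case: (smb_fun_biprod F) (smb_fun_biprod G) => [[F1 F2] F3 F4] [[G1 G2] G3 G4].
  split=> [|x y|x y] /=; [| by rewrite F3 G3 | by rewrite F4 G4].
  by split=> x y /=; [rewrite F1 G1 | rewrite F2 G2].
- case: (smb_fun_mon F) (smb_fun_mon G) => F1 F2 F3 F4 F5 [G1 G2 G3 G4 G5].
  by split=> * /=; rewrite ?(F1, F2, F3, F4, F5) ?(G1, G2, G3, G4, G5).
Defined.

End SMBLaw.

Definition SMBLaw : category.
Proof.
refine (@Category smblaw (@CategoryOn smblaw smblaw_hom smblaw_id smblaw_comp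
  _ _ _)); by move=> *; apply: smblaw_hom_eq.
Defined.

Section CSRng.
Local Open Scope ring_scope.

Lemma rmorphism_eq (S T : pzSemiRingType) (f g : {rmorphism S -> T}) :
  (f : S -> T) = g -> f = g.
Proof.
case: f g => [f [[f0] [f1]]] [g [[g0] [g1]]] /= eqfg.
case: g / eqfg in g0 g1 *.
by rewrite (Prop_irrelevance f0 g0) (Prop_irrelevance f1 g1).
Qed.

Definition rmorphism_id (S : comPzSemiRingType) : {rmorphism S -> S} :=
  [the {rmorphism S -> S} of idfun].

Definition rmorphism_comp (S T U : comPzSemiRingType)
    (g : {rmorphism T -> U}) (f : {rmorphism S -> T}) : {rmorphism S -> U} :=
  [the {rmorphism S -> U} of g \o f].

End CSRng.

(* Objects carry, besides the semiring structure, the equality test and choice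
   operator of choiceType; classically every type has them, and morphisms
   ignore them. The trivial semiring (0 = 1) is allowed. *)
Definition CSRng : category.
Proof.
refine (@Category comPzSemiRingType (@CategoryOn comPzSemiRingType
  (fun S T => {rmorphism S -> T}) rmorphism_id rmorphism_comp _ _ _));
  by move=> *; apply: rmorphism_eq.
Defined.

Section Mat.
Local Open Scope ring_scope.
Variable S : comPzSemiRingType.

(* A matrix in 'M_(n, m) is a morphism n -> m, so composition is
   multiplication in the opposite order. *)
Definition mat_cat : category_on nat :=
  @CategoryOn nat (fun n m => 'M[S]_(n, m)) (fun n => 1%:M)
    (fun n m p h g => g *m h)
    (fun _ _ _ _ h g f => esym (mulmxA f g h))
    (fun _ _ f => mulmx1 f) (fun _ _ f => mul1mx f).

(* The image of a function under the coproduct-preserving functor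
   aleph0 -> Mat(S). *)
Definition mat_fun (n m : nat) (f : hom aleph0 n m) : hom mat_cat n m :=
  \matrix_(i, j) (f i == j)%:R.

Definition mat_inj1 (n m : nat) : hom mat_cat n (n + m) :=
  \matrix_(i, j) (i == j :> nat)%:R.

Definition mat_inj2 (n m : nat) : hom mat_cat m (n + m) :=
  \matrix_(i, j) ((n <= j) && (j - n == i))%N%:R.

Definition mat_proj1 (n m : nat) : hom mat_cat (n + m) n := (mat_inj1 n m)^T.
Definition mat_proj2 (n m : nat) : hom mat_cat (n + m) m := (mat_inj2 n m)^T.

Definition mat_tensor (n n' m m' : nat)
    (g : hom mat_cat n n') (h : hom mat_cat m m') :
    hom mat_cat (n * m)%N (n' * m')%N :=
  \matrix_(i, j) (g (co i).1 (co j).1 * h (co i).2 (co j).2).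

Lemma mat_fun_mul n m p (f : hom aleph0 n m) (A : 'M[S]_(m, p)) :
  mat_fun f *m A = \matrix_(i, j) A (f i) j.
Proof.
apply/matrixP => i j; rewrite !mxE (bigD1 (f i)) //= !mxE eqxx mul1r.
by rewrite big1 ?addr0 // => k; rewrite mxE eq_sym => /negPf ->; rewrite mul0r.
Qed.

Lemma mat_mul_fun n m p (f : hom aleph0 m p) (g : 'I_p -> 'I_m)
  (A : 'M[S]_(n, m)) : cancel f g -> cancel g f ->
  A *m mat_fun f = \matrix_(i, j) A i (g j).
Proof.
move=> fK gK; apply/matrixP => i j; rewrite !mxE (bigD1 (g j)) //= !mxE gK eqxx.
rewrite mulr1 big1 ?addr0 // => k /negPf nk.
by rewrite mxE (can2_eq fK gK) nk mulr0.
Qed.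

Lemma mat_fun1 n : mat_fun (fun i : 'I_n => i) = 1%:M.
Proof. by apply/matrixP => i j; rewrite !mxE. Qed.

Lemma mat_funM n m p (g : hom aleph0 m p) (f : hom aleph0 n m) :
  mat_fun (g ∘ f) = mat_fun f *m mat_fun g.
Proof. by rewrite mat_fun_mul; apply/matrixP => i j; rewrite !mxE. Qed.

Definition mat_incl : io_functor aleph0 mat_cat :=
  @IoFunctor nat aleph0 mat_cat mat_fun mat_fun1 mat_funM.

Lemma mat_inj1_fun n m : mat_inj1 n m = mat_fun (@lshift n m).
Proof. by apply/matrixP => i j; rewrite !mxE. Qed.

Lemma mat_inj2_fun n m : mat_inj2 n m = mat_fun (@rshift n m).
Proof.
apply/matrixP => i j; rewrite !mxE; congr (nat_of_bool _)%:R.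
rewrite -val_eqE /=; case: leqP => [le_nj|lt_jn] /=.
  by rewrite -(eqn_add2l n) subnKC // eq_sym.
by apply/esym/negbTE; rewrite gtn_eqF // ltn_addr.
Qed.

Lemma mat_inj1E n m : mat_inj1 n m = row_mx 1%:M 0.
Proof.
apply/matrixP => i j; rewrite !mxE; case: splitP => k jk; rewrite !mxE.
  by rewrite jk.
by rewrite jk ltn_eqF // ltn_addr.
Qed.

Lemma mat_inj2E n m : mat_inj2 n m = row_mx 0 1%:M.
Proof.
apply/matrixP => i j; rewrite !mxE; case: splitP => k jk; rewrite !mxE jk.
  by rewrite leqNgt ltn_ord.
by rewrite leq_addr addKn eq_sym.
Qed.

Definition mat_coproducts : coproducts mat_cat addn 0.
Proof.
refine (@Coproducts nat mat_cat addn 0%N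
  (fun n => 0 : 'M[S]_(0, n)) _ mat_inj1 mat_inj2
  (fun n m p (f : 'M[S]_(n, p)) (g : 'M[S]_(m, p)) => col_mx f g) _ _ _).
- by move=> n f; apply: flatmx0.
- by move=> n m p f g /=; rewrite mat_inj1E mul_row_col mul1mx mul0mx addr0.
- by move=> n m p f g /=; rewrite mat_inj2E mul_row_col mul1mx mul0mx add0r.
- move=> n m p h /=; rewrite -[h]vsubmxK mat_inj1E mat_inj2E !mul_row_col.
  by rewrite !mul1mx !mul0mx addr0 add0r.
Defined.

Definition mat_biproducts : biproducts mat_coproducts.
Proof.
refine (@Biproducts nat mat_cat addn 0%N mat_coproducts
  (fun n => 0 : 'M[S]_(n, 0)) _ mat_proj1 mat_proj2
  (fun n m p (f : 'M[S]_(p, n)) (g : 'M[S]_(p, m)) => row_mx f g)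
  _ _ _ _ _ _ _);
  rewrite /= /mat_proj1 /mat_proj2.
- by move=> n f; apply: thinmx0.
- move=> n m p f g; rewrite mat_inj1E tr_row_mx mul_row_col trmx1 trmx0.
  by rewrite mulmx1 mulmx0 addr0.
- move=> n m p f g; rewrite mat_inj2E tr_row_mx mul_row_col trmx1 trmx0.
  by rewrite mulmx1 mulmx0 add0r.
- move=> n m p h; rewrite -[h]hsubmxK mat_inj1E mat_inj2E !tr_row_mx.
  by rewrite !mul_row_col !trmx1 !trmx0 !mulmx1 !mulmx0 addr0 add0r.
- move=> n m; rewrite mat_inj1E tr_row_mx mul_row_col trmx1 trmx0.
  by rewrite mulmx1 mulmx0 addr0.
- move=> n m; rewrite mat_inj2E tr_row_mx mul_row_col trmx1 trmx0.
  by rewrite mulmx1 mulmx0 add0r.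
- move=> n m; rewrite mat_inj1E mat_inj2E tr_row_mx mul_row_col trmx1 trmx0.
  by rewrite mulmx1 !mulmx0 addr0.
- move=> n m; rewrite mat_inj1E mat_inj2E tr_row_mx mul_row_col trmx1 trmx0.
  by rewrite mulmx1 !mulmx0 addr0.
Defined.

Lemma mat_tensor1 n m : mat_tensor (idm n) (idm m) = 1%:M.
Proof.
apply/matrixP => i j; rewrite !mxE -natrM mulnb; congr (nat_of_bool _)%:R.
by rewrite -(can_eq (@coK n m)) -pair_eqE.
Qed.

Lemma mat_tensorM n n' n'' m m' m''
  (f' : hom mat_cat n' n'') (f : hom mat_cat n n')
  (g' : hom mat_cat m' m'') (g : hom mat_cat m m') :
  mat_tensor (f' ∘ f) (g' ∘ g) = mat_tensor f' g' ∘ mat_tensor f g.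
Proof.
apply/matrixP => i j; rewrite !mxE big_distrlr /= pair_big /=.
rewrite (reindex (@co n' m')) /=; last first.
  by exists (@coV n' m') => k _; [apply: coK | apply: coVK].
by apply: eq_bigr => k _; rewrite !mxE mulrACA.
Qed.

Lemma mat_fun_tensor n n' m m' (f : hom aleph0 n n') (g : hom aleph0 m m') :
  mat_fun (a0_tensor f g) = mat_tensor (mat_fun f) (mat_fun g).
Proof.
apply/matrixP => i j; rewrite !mxE -natrM mulnb; congr (nat_of_bool _)%:R.
by rewrite -(can_eq (@coK _ _)) /a0_tensor coVK -pair_eqE.
Qed.

Lemma mat_fun_iso n m (f : hom aleph0 n m) : is_iso f -> is_iso (mat_fun f).
Proof.
by case=> g [gf fg]; exists (mat_fun g); rewrite /= -!mat_funM gf fg !mat_fun1.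
Qed.

Definition mat_symmonoidal : symmonoidal mat_cat muln 1.
Proof.
refine (@SymMonoidal nat mat_cat muln 1%N mat_tensor mat_tensor1 mat_tensorM
  (fun n m p => mat_fun (@a0_assoc n m p)) (fun n => mat_fun (@a0_lunit n))
  (fun n => mat_fun (@a0_runit n)) (fun n m => mat_fun (@a0_swap n m))
  _ _ _ _ _ _ _ _ _ _ _ _).
- by move=> n m p; apply: mat_fun_iso (assoc_iso aleph0_symmonoidal n m p).
- by move=> n; apply: mat_fun_iso (lunit_iso aleph0_symmonoidal n).
- by move=> n; apply: mat_fun_iso (runit_iso aleph0_symmonoidal n).
- move=> n n' m m' p p' f g h /=; rewrite mat_fun_mul.
  rewrite (mat_mul_fun _ (@a0_assocK _ _ _) (@a0_assocVK _ _ _)).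
  by apply/matrixP => i j; rewrite !mxE /a0_assoc /a0_assocV !coVK mulrA.
- move=> n n' f /=; rewrite mat_fun_mul.
  rewrite (mat_mul_fun _ (@a0_lunitK _) (@a0_lunitVK _)).
  apply/matrixP => i j; rewrite !mxE /a0_lunit /a0_lunitV !coVK.
  by rewrite [(co i).1]ord1 mul1r.
- move=> n n' f /=; rewrite mat_fun_mul.
  rewrite (mat_mul_fun _ (@a0_runitK _) (@a0_runitVK _)).
  apply/matrixP => i j; rewrite !mxE /a0_runit /a0_runitV !coVK.
  by rewrite [(co i).2]ord1 mulr1.
- move=> n n' m m' f g /=; rewrite mat_fun_mul.
  rewrite (mat_mul_fun _ (@a0_swapK _ _) (@a0_swapK _ _)).
  by apply/matrixP => i j; rewrite !mxE /a0_swap !coVK mulrC.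
- move=> n m p q /=; rewrite -mat_fun1 -mat_fun1 -!mat_fun_tensor -!mat_funM.
  by congr mat_fun; apply: (pentagon aleph0_symmonoidal).
- move=> n m /=; rewrite -mat_fun1 -mat_fun1 -!mat_fun_tensor -!mat_funM.
  by congr mat_fun; apply: (triangle aleph0_symmonoidal).
- move=> n m p /=; rewrite -mat_fun1 -mat_fun1 -!mat_fun_tensor -!mat_funM.
  by congr mat_fun; apply: (hexagon aleph0_symmonoidal).
- by move=> n /=; rewrite -!mat_funM; congr mat_fun; apply: (lunit_swap aleph0_symmonoidal).
- move=> n m /=; rewrite -!mat_funM -mat_fun1.
  by congr mat_fun; apply: (swapK aleph0_symmonoidal).
Defined.

Definition mat_lawvere : lawvere.
Proof.
refine (@Lawvere mat_cat mat_coproducts mat_incl _).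
by split=> n m /=; rewrite (mat_inj1_fun, mat_inj2_fun).
Defined.

Definition mat_smblaw : smblaw.
Proof.
refine (@SMBLawvere mat_lawvere mat_symmonoidal _ mat_biproducts).
by split=> //= *; apply: mat_fun_tensor.
Defined.

End Mat.

Section MatMap.
Local Open Scope ring_scope.
Variables (S T : comPzSemiRingType) (f : {rmorphism S -> T}).

Lemma mat_map1 n : map_mx f (1%:M : 'M_n) = 1%:M.
Proof. exact: map_mx1. Qed.

Definition mat_map : io_functor (mat_cat S) (mat_cat T) :=
  @IoFunctor nat (mat_cat S) (mat_cat T) (fun n m h => map_mx f h)
    mat_map1 (fun n m p h g => map_mxM f g h).

Lemma map_mat_fun n m (h : hom aleph0 n m) :
  map_mx f (mat_fun S h) = mat_fun T h.
Proof. by apply/matrixP => i j; rewrite !mxE rmorph_nat. Qed.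

Definition mat_smblaw_hom : smblaw_hom (mat_smblaw S) (mat_smblaw T).
Proof.
exists mat_map.
- split; first split; move=> n m; apply/matrixP => i j;
    by rewrite !mxE rmorph_nat.
- split=> [n n' m m' g h|n m p|n|n|n m] /=; try exact: map_mat_fun.
  by apply/matrixP => i j; rewrite !mxE rmorphM.
Defined.

End MatMap.

Definition Mat : functor CSRng SMBLaw.
Proof.
refine (@Functor CSRng SMBLaw mat_smblaw mat_smblaw_hom _ _).
- by move=> S; apply: smblaw_hom_eq => n m h; apply/matrixP => i j; rewrite mxE.
- by move=> S T U g f; apply: smblaw_hom_eq => n m h; apply: map_mx_comp.
Defined.

(* An alias carrying the semiring structure: on hom L 1 1 itself it would
   clash with other structures when hom L reduces to a concrete type. *)
Definition endo (L : smblaw) : Type := hom L 1 1.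

HB.instance Definition _ (L : smblaw) := gen_eqMixin (endo L).
HB.instance Definition _ (L : smblaw) := gen_choiceMixin (endo L).

Section Endo.
Variable L : smblaw.
Let K := law_coprod L.
Let B := smb_biprod L.
Let T := smb_mon L.

Local Notation "[ f , g ]" := (cotuple K f g).
Local Notation "⟨ f , g ⟩" := (tuple B f g).
Local Notation "f ⊕ g" := (osum K f g).
Local Notation "f ⊗ g" := (tensor T f g).

Definition endo_zero : endo L := zero_map B 1 1.

Definition endo_add (f g : endo L) : endo L :=
  [idm 1, idm 1] ∘ (f ⊕ g) ∘ ⟨idm 1, idm 1⟩.

Definition endo_mul (f g : endo L) : endo L := f ∘ g.

Lemma cotupleE n m p (h h' : hom L (n + m) p) :
  h ∘ inj1 K n m = h' ∘ inj1 K n m -> h ∘ inj2 K n m = h' ∘ inj2 K n m -> h = h'.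
Proof. by move=> e1 e2; rewrite (cotuple_uniq K h) e1 e2 -cotuple_uniq. Qed.

Lemma tupleE n m p (h h' : hom L p (n + m)) :
  proj1 B n m ∘ h = proj1 B n m ∘ h' -> proj2 B n m ∘ h = proj2 B n m ∘ h' ->
  h = h'.
Proof. by move=> e1 e2; rewrite (tuple_uniq B h) e1 e2 -tuple_uniq. Qed.

Lemma cotuple_comp n m p q (h : hom L p q) (f : hom L n p) (g : hom L m p) :
  h ∘ [f, g] = [h ∘ f, h ∘ g].
Proof. by apply: cotupleE; rewrite -compA ?cotuple1 ?cotuple2. Qed.

Lemma tuple_comp n m p q (h : hom L q p) (f : hom L p n) (g : hom L p m) :
  ⟨f, g⟩ ∘ h = ⟨f ∘ h, g ∘ h⟩.
Proof. by apply: tupleE; rewrite compA ?tuple1 ?tuple2. Qed.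

Lemma zero_compl n m p (f : hom L n m) : zero_map B m p ∘ f = zero_map B n p.
Proof. by rewrite /zero_map -compA (term_uniq B (_ ∘ f)). Qed.

Lemma zero_compr n m p (f : hom L m p) : f ∘ zero_map B n m = zero_map B n p.
Proof. by rewrite /zero_map compA (init_uniq K (f ∘ _)). Qed.

Lemma inj1_tuple n m : inj1 K n m = ⟨idm n, zero_map B n m⟩.
Proof.
by apply: tupleE; rewrite ?tuple1 ?tuple2 ?proj1_inj1 ?proj2_inj1.
Qed.

Lemma inj2_tuple n m : inj2 K n m = ⟨zero_map B m n, idm m⟩.
Proof.
by apply: tupleE; rewrite ?tuple1 ?tuple2 ?proj1_inj2 ?proj2_inj2.
Qed.

Lemma osum_tuple n m p q r (f : hom L n p) (g : hom L m q)
  (h : hom L r n) (k : hom L r m) : (f ⊕ g) ∘ ⟨h, k⟩ = ⟨f ∘ h, g ∘ k⟩.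
Proof.
suff -> : f ⊕ g = ⟨f ∘ proj1 B n m, g ∘ proj2 B n m⟩.
  by rewrite tuple_comp -!compA tuple1 tuple2.
apply: cotupleE; rewrite /osum ?cotuple1 ?cotuple2 tuple_comp -!compA.
- rewrite proj1_inj1 proj2_inj1 compm1 -/(zero_map B _ _) zero_compr.
  by rewrite inj1_tuple tuple_comp comp1m zero_compl.
- rewrite proj1_inj2 proj2_inj2 compm1 -/(zero_map B _ _) zero_compr.
  by rewrite inj2_tuple tuple_comp comp1m zero_compl.
Qed.

Lemma endo_addE1 f g : endo_add f g = [idm 1, idm 1] ∘ ⟨f, g⟩.
Proof. by rewrite /endo_add -compA osum_tuple !compm1. Qed.

Lemma endo_addE2 f g : endo_add f g = [f, g] ∘ ⟨idm 1, idm 1⟩.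
Proof.
rewrite /endo_add /osum cotuple_comp; congr (_ ∘ _).
by rewrite !compA cotuple1 cotuple2 !comp1m.
Qed.

Lemma endo_addI a b c d :
  endo_add (endo_add a b) (endo_add c d) = endo_add (endo_add a c) (endo_add b d).
Proof.
rewrite [LHS]endo_addE2 [RHS]endo_addE1.
rewrite (endo_addE1 a b) (endo_addE1 c d) (endo_addE2 a c) (endo_addE2 b d).
rewrite -cotuple_comp -tuple_comp compA; congr (_ ∘ _ ∘ _).
apply: tupleE; rewrite cotuple_comp ?tuple1 ?tuple2; congr cotuple.
Qed.

Lemma endo_add0r : left_id endo_zero endo_add.
Proof.
move=> f; rewrite endo_addE1 (_ : ⟨_, _⟩ = inj2 K 1 1 ∘ f).
  by rewrite compA cotuple2 comp1m.
by rewrite inj2_tuple tuple_comp zero_compl comp1m.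
Qed.

Lemma endo_addr0 : right_id endo_zero endo_add.
Proof.
move=> f; rewrite endo_addE1 (_ : ⟨_, _⟩ = inj1 K 1 1 ∘ f).
  by rewrite compA cotuple1 comp1m.
by rewrite inj1_tuple tuple_comp zero_compl comp1m.
Qed.

Lemma endo_addC : commutative endo_add.
Proof.
move=> f g; rewrite -{1}[f]endo_add0r -{1}[g]endo_addr0 endo_addI.
by rewrite endo_add0r endo_addr0.
Qed.

Lemma endo_addA : associative endo_add.
Proof. by move=> f g h; rewrite -{1}[f]endo_addr0 endo_addI endo_add0r. Qed.

Lemma endo_mulA : associative endo_mul.
Proof. by move=> f g h; rewrite /endo_mul compA. Qed.

Lemma endo_mul1 : left_id (idm 1 : endo L) endo_mul.
Proof. by move=> f; apply: comp1m. Qed.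

Lemma endo_mul0 : left_zero endo_zero endo_mul.
Proof. by move=> f; apply: zero_compl. Qed.

Lemma endo_mulDl : left_distributive endo_mul endo_add.
Proof.
by move=> f g h; rewrite /endo_mul !endo_addE1 -compA tuple_comp.
Qed.

(* The unit constraints at 1 are images of the only function from {0} to
   itself, so tensoring with the identity of 1 does nothing. *)
Lemma tensor_1_endo (f : endo L) : idm 1 ⊗ f = f.
Proof.
have l1 : lunit T 1 = idm 1.
  rewrite -(pres_lunit (smb_inclP L)) -(iomap1 (law_incl L)).
  by congr iomap; apply/functional_extensionality_dep => i; rewrite !ord1.
by have := lunit_nat T f; rewrite l1 comp1m compm1.
Qed.

Lemma tensor_endo_1 (f : endo L) : f ⊗ idm 1 = f.
Proof.
have r1 : runit T 1 = idm 1.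
  rewrite -(pres_runit (smb_inclP L)) -(iomap1 (law_incl L)).
  by congr iomap; apply/functional_extensionality_dep => i; rewrite !ord1.
by have := runit_nat T f; rewrite r1 comp1m compm1.
Qed.

Lemma endo_mulC : commutative endo_mul.
Proof.
move=> f g; rewrite /endo_mul.
have fgE : f ⊗ g = f ∘ g.
  have := tensorM T f (idm 1) (idm 1) g.
  by rewrite comp1m compm1 tensor_endo_1 tensor_1_endo.
have := tensorM T (idm 1) f g (idm 1).
by rewrite comp1m compm1 tensor_endo_1 tensor_1_endo fgE.
Qed.

End Endo.

HB.instance Definition _ (L : smblaw) := GRing.isNmodule.Build (endo L)
  (@endo_addA L) (@endo_addC L) (@endo_add0r L).
HB.instance Definition _ (L : smblaw) :=
  GRing.Nmodule_isComPzSemiRing.Build (endo L)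
    (@endo_mulA L) (@endo_mulC L) (@endo_mul1 L) (@endo_mulDl L) (@endo_mul0 L).

Section EndoMap.
Variables (L M : smblaw) (F : smblaw_hom L M).

Definition endo_map (f : endo L) : endo M := iomap F f.

Lemma iomap_zero n m :
  iomap F (zero_map (smb_biprod L) n m) = zero_map (smb_biprod M) n m.
Proof.
rewrite /zero_map iomapM; congr (_ ∘ _).
- exact: init_uniq.
- exact: term_uniq.
Qed.

Lemma iomap_cotuple n m p (f : hom L n p) (g : hom L m p) :
  iomap F (cotuple (law_coprod L) f g)
  = cotuple (law_coprod M) (iomap F f) (iomap F g).
Proof.
case: (smb_fun_biprod F) => [[F1 F2] _ _].
by apply: cotupleE; rewrite ?cotuple1 ?cotuple2 -?F1 -?F2 -iomapM
  ?cotuple1 ?cotuple2.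
Qed.

Lemma iomap_tuple n m p (f : hom L p n) (g : hom L p m) :
  iomap F (tuple (smb_biprod L) f g)
  = tuple (smb_biprod M) (iomap F f) (iomap F g).
Proof.
case: (smb_fun_biprod F) => [_ F1 F2].
by apply: tupleE; rewrite ?tuple1 ?tuple2 -?F1 -?F2 -iomapM ?tuple1 ?tuple2.
Qed.

Lemma endo_map_nmod : nmod_morphism endo_map.
Proof.
split=> [|f g]; first exact: iomap_zero.
by rewrite /GRing.add /= !endo_addE1 /endo_map iomapM iomap_cotuple iomap_tuple !iomap1.
Qed.

Lemma endo_map_monoid : monoid_morphism endo_map.
Proof. by split=> [|f g]; [apply: iomap1 | apply: iomapM]. Qed.

HB.instance Definition _ :=
  GRing.isNmodMorphism.Build (endo L) (endo M) endo_map endo_map_nmod.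
HB.instance Definition _ :=
  GRing.isMonoidMorphism.Build (endo L) (endo M) endo_map endo_map_monoid.

Definition endo_rmorphism : {rmorphism endo L -> endo M} :=
  [the {rmorphism endo L -> endo M} of endo_map].

End EndoMap.

Definition H : functor SMBLaw CSRng.
Proof.
refine (@Functor SMBLaw CSRng (fun L => endo L : comPzSemiRingType)
  endo_rmorphism _ _).
- by move=> L; apply: rmorphism_eq.
- by move=> L M N G F; apply: rmorphism_eq.
Defined.

(* Main.v *)
From HB Require Import structures.
From mathcomp Require Import all_boot all_algebra.
From mathcomp Require Import boolp.
Require Import Defs.

(**
  In a category with biproducts whose objects are the natural numbers, n is the
  n-fold biproduct of 1, so a morphism n -> m is the same thing as an n x m
  matrix over the semiring of endomorphisms of 1. Taking matrices of morphisms
  is therefore an isomorphism L -> Mat (H L), and its inverse is the counit of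
  the adjunction. The unit sends s to the 1 x 1 matrix (s).
*)

Set Implicit Arguments.
Unset Strict Implicit.
Unset Printing Implicit Defensive.

Import GRing.Theory.

(** * Preservation of biproducts, and inverses of morphisms *)

(** Each projection is the cotuple of an identity and a zero map, and zero maps are preserved
    because they factor through the object 0. *)
Lemma coproducts_biproducts_preserved (L M : smblaw) (F : io_functor L M) :
  preserves_coproducts (law_coprod L) (law_coprod M) F ->
  preserves_biproducts (smb_biprod L) (smb_biprod M) F.
Proof.
move=> FK; case: (FK) => F1 F2.
have F0 n m : iomap F (zero_map (smb_biprod L) n m) = zero_map (smb_biprod M) n m.
  rewrite /zero_map iomapM (init_uniq (law_coprod M) (iomap F _)).
  by rewrite (term_uniq (smb_biprod M) (iomap F _)).
split=> // n m; apply: cotupleE; rewrite -?F1 -?F2 -iomapM.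
- by rewrite proj1_inj1 F1 proj1_inj1 iomap1.
- by rewrite proj1_inj2 F2 proj1_inj2; apply: F0.
- by rewrite proj2_inj1 F1 proj2_inj1; apply: F0.
- by rewrite proj2_inj2 F2 proj2_inj2 iomap1.
Qed.

(** Chosen preimages under [F] form the inverse; since [F] is faithful, each law for it may be
    checked after applying [F]. *)
Lemma smblaw_hom_inverse (L M : smblaw) (F : smblaw_hom L M) :
  (forall n m (g : hom M n m), exists f : hom L n m, iomap F f = g) ->
  (forall n m (f f' : hom L n m), iomap F f = iomap F f' -> f = f') ->
  exists G : smblaw_hom M L, forall n m (g : hom M n m), iomap F (iomap G g) = g.
Proof.
move=> surF injF.
pose G n m (g : hom M n m) : hom L n m := projT1 (cid (surF n m g)).
have GK n m g : iomap F (@G n m g) = g by rewrite /G; case: cid.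
have G1 n : G _ _ (idm n) = idm n by apply: injF; rewrite GK iomap1.
have GM n m p (g : hom M m p) (f : hom M n m) : G _ _ (g ∘ f) = G _ _ g ∘ G _ _ f.
  by apply: injF; rewrite iomapM !GK.
pose G' := IoFunctor G1 GM.
case: (smb_fun_biprod F) => [[F1 F2] _ _].
case: (smb_fun_mon F) => Ften Fass Flun Frun Fswap.
have GB : preserves_biproducts (smb_biprod M) (smb_biprod L) G'.
  by apply: coproducts_biproducts_preserved; split=> n m; apply: injF; rewrite GK.
have GT : preserves_symmonoidal (smb_mon M) (smb_mon L) G'.
  by split=> *; apply: injF; rewrite ?Ften !GK.
by exists (SMBLawHom GB GT).
Qed.

(** * Coordinates on n as the n-fold biproduct of 1 *)

Section Entries.
Variable L : smblaw.
Let K := law_coprod L.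
Let B := smb_biprod L.
Let T := smb_mon L.

Local Notation "f ⊗ g" := (tensor T f g).

(** Taken as the image of a function, so that composites with images of functions, and tensors, are
    computed in [aleph0]. *)
Definition coord_inj n (i : 'I_n) : hom L 1 n :=
  iomap (law_incl L) ((fun=> i) : hom aleph0 1 n).

(** Projections are in general not images of functions, hence the recursion along [1 + m]. *)
Fixpoint coord_proj n : 'I_n -> hom L n 1 :=
  match n with
  | 0 => fun j => match notF (ltn_ord j) with end
  | m.+1 => fun j => match split (j : 'I_(1 + m)) with
                     | inl _ => proj1 B 1 m
                     | inr k => coord_proj k ∘ proj2 B 1 m
                     end
  end.

Lemma incl_coord_inj n m (f : hom aleph0 n m) (i : 'I_n) :
  iomap (law_incl L) f ∘ coord_inj i = coord_inj (f i).
Proof. by rewrite -iomapM. Qed.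

Lemma coord_inj_lshift n m (i : 'I_n) :
  coord_inj (lshift m i) = inj1 K n m ∘ coord_inj i.
Proof. by rewrite -(law_inclP L).1 incl_coord_inj. Qed.

Lemma coord_inj_rshift n m (i : 'I_m) :
  coord_inj (rshift n i) = inj2 K n m ∘ coord_inj i.
Proof. by rewrite -(law_inclP L).2 incl_coord_inj. Qed.

Lemma coord_inj1 (i : 'I_1) : coord_inj i = idm 1.
Proof.
rewrite -(iomap1 (law_incl L)); congr iomap.
by apply/functional_extensionality_dep => j; rewrite !ord1.
Qed.

Lemma coord_proj_lshift m (i : 'I_1) : coord_proj (lshift m i) = proj1 B 1 m.
Proof. by rewrite /= (unsplitK (inl i)). Qed.

Lemma coord_proj_rshift m (j : 'I_m) :
  coord_proj (rshift 1 j) = coord_proj j ∘ proj2 B 1 m.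
Proof. by rewrite /= (unsplitK (inr j)). Qed.

Lemma coord_inj_lshift1 m (i : 'I_1) : coord_inj (lshift m i) = inj1 K 1 m.
Proof. by rewrite coord_inj_lshift coord_inj1 compm1. Qed.

(** Induction along [1 + n]: the two mixed cases factor through a zero map, which is the 0 of
    [endo L]. *)
Lemma coord_projK n (i j : 'I_n) :
  coord_proj j ∘ coord_inj i = ((i == j)%:R%R : endo L).
Proof.
elim: n i j => [[]//|n IHn]; rewrite -[n.+1]/(1 + n)%N => i j.
have zE : zero_map B 1 1 = (0%R : endo L) by [].
rewrite -[i]splitK -[j]splitK; case: (split i) (split j) => [i'|i'] [j'|j'];
  rewrite /unsplit ?coord_inj_lshift1 ?coord_inj_rshift
    ?coord_proj_lshift ?coord_proj_rshift.
- by rewrite !ord1 eqxx proj1_inj1.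
- rewrite -compA proj2_inj1 -/(zero_map B _ _) zero_compr zE.
  by rewrite eq_lrshift.
- by rewrite compA proj1_inj2 -/(zero_map B _ _) zero_compl zE eq_rlshift.
- rewrite compA -[_ ∘ _ ∘ inj2 _ _ _]compA proj2_inj2 compm1 IHn.
  by rewrite eq_rshift.
Qed.

Lemma coord_inj_epi n p (h h' : hom L n p) :
  (forall i, h ∘ coord_inj i = h' ∘ coord_inj i) -> h = h'.
Proof.
elim: n h h' => [h h' _|n IHn]; first by rewrite (init_uniq K h) -(init_uniq K h').
rewrite -[n.+1]/(1 + n)%N => h h' hE.
apply: cotupleE.
  by have := hE (lshift n ord0); rewrite coord_inj_lshift1.
apply: IHn => i; rewrite -!compA -coord_inj_rshift; exact: hE.
Qed.

Lemma coord_proj_mono n p (h h' : hom L p n) :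
  (forall j, coord_proj j ∘ h = coord_proj j ∘ h') -> h = h'.
Proof.
elim: n h h' => [h h' _|n IHn]; first by rewrite (term_uniq B h) -(term_uniq B h').
rewrite -[n.+1]/(1 + n)%N => h h' hE.
apply: tupleE.
  by have := hE (lshift n ord0); rewrite coord_proj_lshift.
by apply: IHn => j; rewrite !compA -coord_proj_rshift; apply: hE.
Qed.

Lemma coord_cotuple n p (b : 'I_n -> hom L 1 p) :
  exists h : hom L n p, forall i, h ∘ coord_inj i = b i.
Proof.
elim: n b => [|n IHn]; first by exists (init K p); case.
rewrite -[n.+1]/(1 + n)%N => b.
have [h hE] := IHn (fun i => b (rshift 1 i)).
exists (cotuple K (b (lshift n ord0)) h) => i.
rewrite -[i]splitK; case: (split i) => k; rewrite /unsplit.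
  by rewrite [k]ord1 coord_inj_lshift1 cotuple1.
by rewrite coord_inj_rshift compA cotuple2 hE.
Qed.

Lemma coord_tuple n p (a : 'I_n -> hom L p 1) :
  exists h : hom L p n, forall j, coord_proj j ∘ h = a j.
Proof.
elim: n a => [|n IHn]; first by exists (term B p); case.
rewrite -[n.+1]/(1 + n)%N => a.
have [h hE] := IHn (fun i => a (rshift 1 i)).
exists (tuple B (a (lshift n ord0)) h) => j.
rewrite -[j]splitK; case: (split j) => k; rewrite /unsplit.
  by rewrite [k]ord1 coord_proj_lshift tuple1.
by rewrite coord_proj_rshift -compA tuple2 hE.
Qed.

(** A cotuple is the codiagonal after a biproduct map, and addition in [endo L] is the codiagonal
    after a tuple. *)
Lemma cotuple_tuple_endo m (x : hom L 1 1) (y : hom L m 1)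
    (u : hom L 1 1) (v : hom L 1 m) :
  cotuple K x y ∘ tuple B u v = ((x ∘ u : endo L) + (y ∘ v : endo L))%R.
Proof.
rewrite [RHS]endo_addE1 -osum_tuple compA; congr (_ ∘ _).
by rewrite /osum cotuple_comp !compA cotuple1 cotuple2 !comp1m.
Qed.

(** This is the biproduct identity, that the [coord_inj j ∘ coord_proj j] sum to the identity, seen
    between maps to and from 1, where sums are available. *)
Lemma comp_coord_sum m (b : hom L m 1) (a : hom L 1 m) :
  b ∘ a = (\sum_(j < m)
    ((b ∘ coord_inj j : endo L) * (coord_proj j ∘ a : endo L)))%R.
Proof.
elim: m b a => [b a|m IHm].
  rewrite big_ord0 (init_uniq K b) (term_uniq B a).
  by rewrite -/(zero_map B _ _).
rewrite -[m.+1]/(1 + m)%N => b a.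
rewrite [b](cotuple_uniq K) [a](tuple_uniq B).
rewrite [LHS]cotuple_tuple_endo IHm big_split_ord big_ord1.
rewrite coord_inj_lshift1 coord_proj_lshift cotuple1 tuple1.
apply: (@f_equal2 (endo L) (endo L) (endo L) (@GRing.add _)); [by []|apply: eq_bigr => j _].
rewrite coord_inj_rshift coord_proj_rshift [cotuple _ _ _ ∘ _]compA cotuple2.
by rewrite -[_ ∘ tuple _ _ _]compA tuple2.
Qed.

(** * The isomorphism from L to matrices over its endomorphism semiring *)

Definition entries n m (h : hom L n m) : 'M[endo L]_(n, m) :=
  (\matrix_(i, j) (coord_proj j ∘ h ∘ coord_inj i : endo L))%R.

(** Identities, coprojections and monoidal isomorphisms are images of functions on both sides, so
    this one computation shows that [entries] preserves them all. *)
Lemma entries_incl n m (f : hom aleph0 n m) :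
  entries (iomap (law_incl L) f) = mat_fun (endo L) f.
Proof.
by apply/matrixP => i j; rewrite !mxE -compA incl_coord_inj coord_projK.
Qed.

Lemma entries1 n : entries (idm n) = idm n :> hom (mat_cat (endo L)) n n.
Proof. by rewrite -(iomap1 (law_incl L)) entries_incl [LHS]mat_fun1. Qed.

Lemma entriesM n m p (h : hom L m p) (g : hom L n m) :
  entries (h ∘ g) = (entries h : hom (mat_cat (endo L)) m p) ∘ entries g.
Proof.
apply/matrixP => i k; rewrite !mxE compA -compA comp_coord_sum.
(* Composition in [mat_cat] is the matrix product in reverse order; commutativity of [endo L]
   reconciles the two. *)
by apply: eq_bigr => j _; rewrite !mxE mulrC compA.
Qed.

(** By interchange, [f ⊗ g] is [f ⊗ idm 1] after [idm 1 ⊗ g]. *)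
Lemma tensor_endo (f g : endo L) : f ⊗ g = (f * g)%R :> endo L.
Proof.
have := tensorM T f (idm 1) (idm 1) g.
by rewrite comp1m compm1 tensor_endo_1 tensor_1_endo.
Qed.

(** In [aleph0] both sides are the same function by computation, as [1 * 1] reduces to [1]. *)
Lemma coord_inj_tensor n m (i : 'I_n) (j : 'I_m) :
  coord_inj i ⊗ coord_inj j = coord_inj (coV (i, j)).
Proof. by rewrite /coord_inj -(pres_tensor (smb_inclP L)). Qed.

(** Tested against every coprojection, which splits as a tensor: interchange then gives a product of
    two Kronecker deltas. *)
Lemma coord_proj_tensor n m (i : 'I_n) (j : 'I_m) :
  coord_proj i ⊗ coord_proj j = coord_proj (coV (i, j)).
Proof.
apply: coord_inj_epi => c; rewrite coord_projK -(coKp c) -coord_inj_tensor.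
transitivity ((coord_proj i ∘ coord_inj (co c).1)
              ⊗ (coord_proj j ∘ coord_inj (co c).2)).
  exact: esym (tensorM T (coord_proj i) (coord_inj (co c).1)
                         (coord_proj j) (coord_inj (co c).2)).
rewrite !coord_projK [LHS]tensor_endo -natrM mulnb.
by rewrite (can_eq (@coVK n m)) -pair_eqE.
Qed.

(** Coordinates at paired indices are tensors, so by interchange an entry is a tensor of
    endomorphisms of 1, that is, their product. *)
Lemma entries_tensor n n' m m' (f : hom L n n') (g : hom L m m') :
  entries (f ⊗ g) = mat_tensor (entries f) (entries g).
Proof.
apply/matrixP => i j; rewrite !mxE -{1}(coKp i) -{1}(coKp j).
rewrite -coord_inj_tensor -coord_proj_tensor.
rewrite -[RHS]tensor_endo [RHS]tensorM tensorM; reflexivity.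
Qed.

Lemma entries_inj n m (h h' : hom L n m) : entries h = entries h' -> h = h'.
Proof.
move=> /matrixP hE; apply: coord_inj_epi => i; apply: coord_proj_mono => j.
by have := hE i j; rewrite !mxE !compA.
Qed.

Lemma entries_surj n m (A : 'M[endo L]_(n, m)) :
  exists h : hom L n m, entries h = A.
Proof.
(* [b i] is row [i] of [A] as a map from 1 to [m]; the cotuple then stacks the rows. *)
have /choice[b bE] i := coord_tuple (fun j => A i j).
have [h hE] := coord_cotuple b.
by exists h; apply/matrixP => i j; rewrite mxE -compA hE bE.
Qed.

Definition entries_functor : io_functor L (mat_cat (endo L)) :=
  IoFunctor entries1 entriesM.

Lemma entries_biproducts : preserves_biproducts (smb_biprod L)
  (smb_biprod (mat_smblaw (endo L))) entries_functor.
Proof.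
apply: coproducts_biproducts_preserved; split=> n m /=.
  by rewrite -(law_inclP L).1 entries_incl mat_inj1_fun.
by rewrite -(law_inclP L).2 entries_incl mat_inj2_fun.
Qed.

Lemma entries_symmonoidal : preserves_symmonoidal (smb_mon L)
  (smb_mon (mat_smblaw (endo L))) entries_functor.
Proof.
case: (smb_inclP L) => _ Fa Fl Fr Fs.
split=> [n n' m m' f g|n m p|n|n|n m] /=; first exact: entries_tensor.
- by rewrite -Fa entries_incl.
- by rewrite -Fl entries_incl.
- by rewrite -Fr entries_incl.
- by rewrite -Fs entries_incl.
Qed.

Definition entries_hom : smblaw_hom L (mat_smblaw (endo L)) :=
  SMBLawHom entries_biproducts entries_symmonoidal.

Lemma entries_endo (f : endo L) : entries f = (f%:M)%R.
Proof.
apply/matrixP => i j; rewrite !mxE coord_inj1 compm1.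
(* The projection from 1 is by definition [proj1 B 1 0]; it is the identity because the coprojection
   is. *)
have := coord_projK i j; rewrite coord_inj1 compm1 => ->.
by rewrite !ord1 [LHS]mul1r.
Qed.

Lemma entries_inverse : exists G : smblaw_hom (mat_smblaw (endo L)) L,
    forall n m (A : 'M[endo L]_(n, m)), entries (iomap G A) = A.
Proof.
exact: (@smblaw_hom_inverse L _ entries_hom entries_surj entries_inj).
Qed.

End Entries.

(** * Morphisms preserve coordinates *)

Section HomCoordinates.
Variables (L M : smblaw) (F : smblaw_hom L M).

Lemma iomap_coord_inj n (i : 'I_n) : iomap F (coord_inj L i) = coord_inj M i.
Proof.
case: (smb_fun_biprod F) => [[F1 F2] _ _].
elim: n i => [[]//|n IHn]; rewrite -[n.+1]/(1 + n)%N => i.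
rewrite -[i]splitK; case: (split i) => k; rewrite /unsplit.
  by rewrite !coord_inj_lshift1 F1.
by rewrite !coord_inj_rshift iomapM F2 IHn.
Qed.

(** Against the coprojections both sides give Kronecker deltas, and [F] acts on endomorphisms of 1
    as a semiring map. *)
Lemma iomap_coord_proj n (j : 'I_n) : iomap F (coord_proj L j) = coord_proj M j.
Proof.
apply: coord_inj_epi => i; rewrite -{1}iomap_coord_inj -iomapM !coord_projK.
exact: (rmorph_nat (endo_rmorphism F)).
Qed.

End HomCoordinates.

(** * The unit of the adjunction *)

Section Unit.
Local Open Scope ring_scope.
Variable S : comPzSemiRingType.

Definition mat_unit_fun (s : S) : endo (mat_smblaw S) := (s%:M : 'M[S]_1).

(** The zero map passes through the object 0, so its entries are empty sums; a sum is the row of two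
    scalars times a column of identities. *)
Lemma mat_unit_nmod : nmod_morphism mat_unit_fun.
Proof.
split=> [|s t]; first by apply/matrixP => i j; rewrite !mxE mul0rn big_ord0.
rewrite [RHS]endo_addE1 /= mul_row_col !mulmx1.
by apply/matrixP => i j; rewrite !mxE mulrnDl.
Qed.

Lemma mat_unit_monoid : monoid_morphism mat_unit_fun.
Proof. by split=> // s t; rewrite mulrC; apply: scalar_mxM. Qed.

HB.instance Definition _ :=
  GRing.isNmodMorphism.Build S (endo (mat_smblaw S)) mat_unit_fun mat_unit_nmod.
HB.instance Definition _ :=
  GRing.isMonoidMorphism.Build S (endo (mat_smblaw S)) mat_unit_fun
    mat_unit_monoid.

Definition mat_unit : {rmorphism S -> endo (mat_smblaw S)} :=
  [the {rmorphism S -> endo (mat_smblaw S)} of mat_unit_fun].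

Lemma mat_unitK (A : endo (mat_smblaw S)) : mat_unit ((A : 'M[S]_1) 0 0) = A.
Proof. exact: esym (mx11_scalar (A : 'M[S]_1)). Qed.

End Unit.

Lemma mat_unit_nat (S T : comPzSemiRingType) (f : {rmorphism S -> T}) (s : S) :
  endo_map (mat_smblaw_hom f) (mat_unit S s) = mat_unit T (f s).
Proof. by apply/matrixP => i j; rewrite !mxE rmorphMn. Qed.

(** * The bijection of hom-sets and its naturality *)

Definition transpose (S : comPzSemiRingType) (L : smblaw)
    (F : smblaw_hom (mat_smblaw S) L) : {rmorphism S -> endo L} :=
  rmorphism_comp (endo_rmorphism F) (mat_unit S).

(** A morphism out of matrices preserves coordinates, so its value at [A] is determined by its
    values at the entries of [A], seen as 1 x 1 matrices. *)
Lemma transpose_inj (S : comPzSemiRingType) (L : smblaw) :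
  injective (@transpose S L).
Proof.
move=> F G FG; apply: smblaw_hom_eq => n m A.
apply: entries_inj; apply/matrixP => i j; rewrite !mxE.
have FE s : iomap F (mat_unit S s) = iomap G (mat_unit S s).
  exact: (congr1 (fun h : {rmorphism S -> endo L} => h s) FG).
have := FE ((coord_proj (mat_smblaw S) j ∘ A ∘ coord_inj (mat_smblaw S) i) ord0 ord0).
by rewrite mat_unitK !iomapM !iomap_coord_inj !iomap_coord_proj.
Qed.

Lemma transpose_surj (S : comPzSemiRingType) (L : smblaw)
    (f : {rmorphism S -> endo L}) :
  exists F : smblaw_hom (mat_smblaw S) L, transpose F = f.
Proof.
have [G GK] := entries_inverse L.
(* The counit [G] after the matrix functor applied to [f]. As [G] is known only through its entries,
   entries are compared. *)
exists (smblaw_comp G (mat_smblaw_hom f)); apply: rmorphism_eq.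
apply/funext => s; apply: entries_inj; rewrite [RHS]entries_endo.
transitivity (map_mx f (mat_unit S s : 'M[S]_1)).
  exact: GK.
exact: (mat_unit_nat f s).
Qed.

Theorem lemma30 : adjoint Mat H.
Proof.
exists transpose; split=> [S L|S S' L L' f F G].
  have [psi psiK] := choice (@transpose_surj S L).
  by exists psi => //; apply: inj_can_sym psiK (@transpose_inj S L).
apply: rmorphism_eq; apply/funext => s.
(* Naturality in [L] holds by computation; naturality in [S] is that of the unit. *)
by rewrite /= /endo_map /= -(mat_unit_nat f s).
Qed.
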